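(* Let $m\ge 1$ and $n=2m$. In $\mathbb{R}^{n+1}$, with coordinates indexed by $\{0,1,\dots,n\}$ and standard unit vectors $e_0,\dots,e_n$, let $q_1=e_1+e_2$ and $q_j=e_{2j-2}+e_{2j-1}+e_{2j}$ for $j=2,\dots,m$, and let $$L_m=\Bigl\{Y\in\mathbb{S}^{n+1}\ \Big|\ Y_{00}=1,\ \ Y_{ii}=Y_{0i}\ (i=1,\dots,n),\ \ \langle q_jq_j^T,Y\rangle=0\ (j=1,\dots,m)\Bigr\}.$$ Then DD-partial facial reduction requires exactly $2m=n$ steps on $L_m\cap\mathbb{S}^{n+1}_+$.
   Context: Notation. $\mathbb{S}^p$ is the space of real symmetric $p\times p$ matrices with inner product $\langle X,Y\rangle=\operatorname{tr}(XY)$, and $\mathbb{S}^p_+$ is the positive semidefinite cone. For a set $S$ of matrices (including an affine subspace), $S^\perp=\{Z\mid\langle Z,X\rangle=0\ \forall X\in S\}$. $\operatorname{ri}$ denotes relative interior. The support of a vector is the set of indices of its nonzero entries. A basis matrix of a subspace is a matrix whose columns form a basis of it. DD cone. $\mathcal{DD}^N=\{X\in\mathbb{S}^N\mid X_{ii}\ge\sum_{j\ne i}|X_{ij}|\ \text{for all } i\}$; it is the cone generated by the matrices $e_ie_i^T$ and $(e_i\pm e_j)(e_i\pm e_j)^T$, $i<j$. DD-partial facial reduction on $L\cap\mathbb{S}^{n+1}_+$. Start with $L_{(0)}=L$ and $N_0=n+1$. At stage $t$, given an affine subspace $L_{(t)}\subseteq\mathbb{S}^{N_t}$: if $L_{(t)}^\perp\cap\mathcal{DD}^{N_t}=\{0\}$,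 terminate. Otherwise perform one step: choose an exposing matrix $W_t\in\operatorname{ri}(L_{(t)}^\perp\cap\mathcal{DD}^{N_t})$, take a basis matrix $V_t\in\mathbb{R}^{N_t\times N_{t+1}}$ of $\ker(W_t)$ with entries in $\{0,\pm1\}$ and pairwise disjoint column supports (such a basis exists because $W_t\in\mathcal{DD}^{N_t}$, and it is unique up to permuting columns and changing their signs), and set $L_{(t+1)}=\{R\in\mathbb{S}^{N_{t+1}}\mid V_tRV_t^T\in L_{(t)}\}$. The number of steps required is the number of steps performed before termination. *)

(* Defs.v *)
From HB Require Import structures.
From mathcomp Require Import all_boot all_order all_algebra.
From mathcomp Require Import all_classical all_reals all_analysis.

Set Implicit Arguments.
Unset Strict Implicit.
Unset Printing Implicit Defensive.

Import Order.TTheory GRing.Theory Num.Theory.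
Import numFieldNormedType.Exports.

Local Open Scope classical_set_scope.
Local Open Scope ring_scope.

Section FacialReduction.
Variable R : realType.

Definition sym_mx (N : nat) : set 'M[R]_N := [set X | X^T = X].

Definition mx_inner (N : nat) (X Y : 'M[R]_N) : R := \tr (X *m Y).

(* The orthogonal of a possibly affine set, taken inside the symmetric
   matrices. *)
Definition perp (N : nat) (S : set 'M[R]_N) : set 'M[R]_N :=
  [set Z | sym_mx Z /\ forall X, S X -> mx_inner Z X = 0].

Definition DD (N : nat) : set 'M[R]_N :=
  [set X | sym_mx X /\ forall i, \sum_(j | j != i) `|X i j| <= X i i].

Definition aff_hull (N : nat) (S : set 'M[R]_N) : set 'M[R]_N :=
  [set X | exists k (a : 'I_k -> R) (Z : 'I_k -> 'M[R]_N),
    [/\ \sum_i a i = 1, forall i, S (Z i) & X = \sum_i a i *: Z i]].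

(* Interior for the subspace topology of the affine hull: S contains all the
   points of aff_hull S that are close enough to X. *)
Definition rel_interior (N : nat) (S : set 'M[R]_N) : set 'M[R]_N :=
  [set X | S X /\ within (aff_hull S) (nbhs X) S].

(* mxalgebra works with row spaces, hence the transpositions: the rows of
   V^T are the columns of V, and the rows of kermx W^T span the transposes of
   the column vectors x such that W *m x = 0. *)
Definition ker_basis_mx (N k : nat) (W : 'M[R]_N) (V : 'M[R]_(N, k)) : Prop :=
  row_free V^T /\ (V^T == kermx W^T)%MS.

Definition sign_entries (N k : nat) (V : 'M[R]_(N, k)) : Prop :=
  forall i j, V i j \in [:: 0; 1; -1].

Definition col_support (N k : nat) (V : 'M[R]_(N, k)) (j : 'I_k) : set 'I_N :=
  [set i | V i j != 0].

Definition disjoint_col_supports (N k : nat) (V : 'M[R]_(N, k)) : Prop :=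
  trivIset setT (col_support V).

Definition reduced_set (N k : nat) (V : 'M[R]_(N, k)) (L : set 'M[R]_N) :
    set 'M[R]_k :=
  [set X | sym_mx X /\ L (V *m X *m V^T)].

Definition dd_terminal (N : nat) (L : set 'M[R]_N) : Prop :=
  perp L `&` @DD N = [set 0].

Definition dd_step (N k : nat) (L : set 'M[R]_N) (L' : set 'M[R]_k) : Prop :=
  exists (W : 'M[R]_N) (V : 'M[R]_(N, k)),
    rel_interior (perp L `&` @DD N) W /\
    [/\ ker_basis_mx W V, sign_entries V, disjoint_col_supports V
      & L' = reduced_set V L].

(* DD-partial facial reduction started at L terminates after exactly t steps,
   whatever exposing matrices and kernel bases are chosen on the way, and it
   never gets stuck before that.  The cone of positive semidefinite matrices
   is implicit, since every step of the procedure only involves the affine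
   subspace. *)
Fixpoint dd_fr_requires (t : nat) (N : nat) (L : set 'M[R]_N) : Prop :=
  match t with
  | 0%N => dd_terminal L
  | t'.+1 =>
      [/\ ~ dd_terminal L,
          exists k (L' : set 'M[R]_k), dd_step L L'
        & forall k (L' : set 'M[R]_k), dd_step L L' -> dd_fr_requires t' L']
  end.

(* [inord k] is only meaningful for k <= n. *)
Definition evec (n k : nat) : 'cV[R]_n.+1 := delta_mx (inord k) 0.

Definition qvec (m j : nat) : 'cV[R]_((2 * m).+1) :=
  if j == 1%N then evec (2 * m) 1 + evec (2 * m) 2
  else evec (2 * m) (2 * j - 2) + evec (2 * m) (2 * j - 1)
       + evec (2 * m) (2 * j).

Definition Lset (m : nat) : set 'M[R]_((2 * m).+1) :=
  [set Y | [/\ sym_mx Y,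
               Y ord0 ord0 = 1,
               forall i, i != ord0 -> Y i i = Y ord0 i
             & forall j, (1 <= j <= m)%N ->
                 mx_inner (qvec m j *m (qvec m j)^T) Y = 0]].

End FacialReduction.

Arguments DD : clear implicits.
Arguments Lset : clear implicits.

(* Main.v *)
(* Let U be the product of the kernel bases of the first t steps, so that the
   current subspace is {X | U X U^T in L_m}. Writing s = t / 2 (rounded down),
   a = 2s + 1 and b = 2s + 2, the column space of U is
   {x | x_1 = ... = x_2s = 0}, with the extra equation x_a + x_b = 0 when t is
   odd; so after deleting the rows 1, ..., 2s, and also b when t is odd, U
   becomes a signed permutation matrix. Transported to the original coordinates
   by this matrix, a diagonally dominant exposing matrix Z has a zero 0th row
   because Y_00 is only constrained by Y_00 = 1. Coordinate 2j - 1 occurs in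
   q_j only, which forces Z_ii = Z_i,2j = +-Z_ik for i = 2j - 1 >= 2s + 3 and a
   third index k; diagonal dominance of row i then gives Z_ii = 0, and the rows
   of even index >= 2s + 4 vanish with them. What remains is the ray spanned by
   w w^T, where w = e_a + e_b for even t and w = e_a for odd t (there the two
   constraints Y_aa = Y_0a and Y_bb = Y_0b, with row b opposite to row a, give
   Y_aa = 0). Hence each step adds the equation w^T x = 0, and only e_0 is left
   after 2m steps. *)
Require Import Defs.
From mathcomp Require Import all_boot all_order all_algebra.
From mathcomp Require Import all_classical all_reals all_analysis.
From mathcomp Require Import zify lra.

Set Implicit Arguments.
Unset Strict Implicit.
Unset Printing Implicit Defensive.

Import Order.TTheory GRing.Theory Num.Theory.
Import numFieldNormedType.Exports.

Local Open Scope classical_set_scope.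
Local Open Scope ring_scope.

(** * Congruences, diagonally dominant matrices and relative interiors *)

Section Generic.
Variable R : realType.

Lemma reduced_set_comp N k l (U : 'M[R]_(N, k)) (V : 'M[R]_(k, l)) L :
  reduced_set V (reduced_set U L) = reduced_set (U *m V) L.
Proof.
apply/seteqP; split=> X [symX].
  by move=> [_ LX]; split; rewrite // trmx_mul !mulmxA in LX *.
rewrite trmx_mul !mulmxA => LX; split=> //; split; last by rewrite !mulmxA.
by rewrite /sym_mx /= !trmx_mul trmxK symX mulmxA.
Qed.

Lemma sign_entriesP N k (U : 'M[R]_(N, k)) i j :
  sign_entries U -> U i j != 0 -> U i j ^+ 2 = 1 /\ `|U i j| = 1.
Proof.
move=> sU; have := sU i j; rewrite !inE.
by case/or3P=> /eqP->; rewrite ?eqxx ?expr1n ?sqrrN ?normrN ?normr1 ?expr1n.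
Qed.

Lemma disjoint_col_supportsP N k (U : 'M[R]_(N, k)) :
  disjoint_col_supports U <->
  forall i j j', U i j != 0 -> U i j' != 0 -> j = j'.
Proof.
split=> [tU i j j' Uj Uj'|tU j j' _ _ [i [Uj Uj']]]; last exact: (tU i).
by apply: (tU j j') => //; exists i.
Qed.

Lemma sum_single k (F : 'I_k -> R) l :
  (forall l', l' != l -> F l' = 0) -> \sum_i F i = F l.
Proof. by move=> F0; rewrite (bigD1 l)//= big1 ?addr0. Qed.

Lemma mx11_eq0 (A : 'M[R]_1) : A = 0 <-> A 0 0 = 0.
Proof.
split=> [->|A0]; first by rewrite mxE.
by apply/matrixP => a b; rewrite !ord1 A0 mxE.
Qed.

Lemma dot_mxC N (x y : 'cV[R]_N) : (x^T *m y) 0 0 = (y^T *m x) 0 0.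
Proof.
by rewrite !mxE; apply: eq_bigr => i _; rewrite !mxE mulrC.
Qed.

Lemma mx_inner_congr N k (S : 'M[R]_(N, k)) Z Y :
  mx_inner (S *m Z *m S^T) Y = mx_inner Z (S^T *m Y *m S).
Proof. by rewrite /mx_inner -!mulmxA mxtrace_mulC !mulmxA. Qed.

Lemma mx_inner_rank1 N (x y : 'cV[R]_N) X :
  mx_inner (x *m y^T) X = (y^T *m X *m x) 0 0.
Proof. by rewrite /mx_inner -mulmxA mxtrace_mulC trace_mx11. Qed.

Lemma mx_inner_rank1r N (x y : 'cV[R]_N) X :
  mx_inner X (x *m y^T) = (y^T *m X *m x) 0 0.
Proof. by rewrite -mx_inner_rank1 /mx_inner mxtrace_mulC. Qed.

Lemma DD_entry N (X : 'M[R]_N) i j : DD R N X -> `|X i j| <= X i i.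
Proof.
move=> [_ /(_ i)]; have := eqVneq j i; case=> [->|ji].
  move=> h; rewrite ger0_norm ?lexx//; apply: le_trans h.
  exact: sumr_ge0.
by apply: le_trans; rewrite (bigD1 j)//= lerDl sumr_ge0.
Qed.

Lemma DD_two_entries N (X : 'M[R]_N) i j k : DD R N X ->
  j != i -> k != i -> j != k -> `|X i j| + `|X i k| <= X i i.
Proof.
move=> [_ /(_ i) h] ji ki jk; apply: le_trans h.
rewrite (bigD1 j)//= (bigD1 k)/=; last by rewrite ki eq_sym.
by rewrite addrA lerDl sumr_ge0.
Qed.

(** Such an [S] is a signed partial permutation matrix: a row of the congruence is zero, or it is a
    row of [Z] with entries permuted, re-signed or dropped and zeros inserted, with the same
    diagonal entry. *)
Lemma DD_congr N k (S : 'M[R]_(N, k)) Z :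
  sign_entries S ->
  (forall r l l', S r l != 0 -> S r l' != 0 -> l = l') ->
  (forall r r' l, S r l != 0 -> S r' l != 0 -> r = r') ->
  DD R k Z -> DD R N (S *m Z *m S^T).
Proof.
move=> sS rowS colS [symZ ddZ]; split.
  by rewrite /sym_mx /= !trmx_mul trmxK symZ mulmxA.
move=> r; set Y := S *m Z *m S^T.
have [/existsP[l Srl]|/existsPn S0] := boolP [exists l, S r l != 0].
  have YE r' : Y r r' = S r l * \sum_l' Z l l' * S r' l'.
    rewrite !mxE mulr_sumr; apply: eq_bigr => l' _.
    rewrite !mxE (@sum_single _ _ l) ?mulrA// => i il.
    have [->|/rowS/(_ Srl)] := eqVneq (S r i) 0; first by rewrite mul0r.
    by move=> e; rewrite e eqxx in il.
  have nS r' l' : `|S r' l'| <= 1.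
    have [->|/(sign_entriesP sS)[_ ->]//] := eqVneq (S r' l') 0.
    by rewrite normr0 ler01.
  have [S1 nS1] := sign_entriesP sS Srl.
  have -> : Y r r = Z l l.
    rewrite YE (@sum_single _ _ l) => [|i il].
      by rewrite mulrCA -expr2 S1 mulr1.
    have [->|/rowS/(_ Srl)] := eqVneq (S r i) 0; first by rewrite mulr0.
    by move=> e; rewrite e eqxx in il.
  apply: le_trans (ddZ l).
  have le1 : \sum_(j | j != r) `|Y r j|
      <= \sum_(j | j != r) \sum_l' `|Z l l'| * `|S j l'|.
    apply: ler_sum => j _; rewrite YE normrM nS1 mul1r.
    by apply: le_trans (ler_norm_sum _ _ _) _; under eq_bigr do rewrite normrM.
  apply: le_trans le1 _; rewrite exchange_big/= (bigD1 l)//= big1 ?add0r.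
    apply: ler_sum => l' _; rewrite -mulr_sumr ler_piMr//.
    have [/existsP[r1 Sr1]|/existsPn S0] := boolP [exists r1, S r1 l' != 0].
      apply: (@le_trans _ _ (\sum_j `|S j l'|)).
        by rewrite [leRHS](bigID (fun j => j != r))/= lerDl sumr_ge0.
      rewrite (@sum_single _ _ r1)// => i ir.
      have [->|/colS/(_ Sr1)] := eqVneq (S i l') 0; first by rewrite normr0.
      by move=> e; rewrite e eqxx in ir.
    rewrite big1// => j _; have := S0 j; rewrite negbK => /eqP->.
    by rewrite normr0.
  move=> j jr; have [->|/colS/(_ Srl)] := eqVneq (S j l) 0.
    by rewrite normr0 mulr0.
  by move=> e; rewrite e eqxx in jr.
have Y0 r' : Y r r' = 0.
  rewrite !mxE big1// => l _; rewrite !mxE big1 ?mul0r// => l' _.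
  by have := S0 l'; rewrite negbK => /eqP->; rewrite mul0r.
by rewrite Y0 big1// => j _; rewrite Y0 normr0.
Qed.

(** The affine hull of the ray is its line, where only the endpoint 0 of the ray fails to be
    interior. *)
Lemma rel_interior_ray N (S : set 'M[R]_N) (W0 : 'M[R]_N) :
  W0 != 0 -> (forall X, S X <-> exists2 c, 0 <= c & X = c *: W0) ->
  forall W, rel_interior S W <-> exists2 c, 0 < c & W = c *: W0.
Proof.
move=> W0N0 SE W.
have [i [j Wij]] : exists i j, W0 i j != 0.
  apply/not_existsP => H; move/eqP: W0N0; apply; apply/matrixP => i j.
  by rewrite mxE; apply/eqP; apply: contrapT => /negP Wij; apply: (H i); exists j.
split=> [[/SE[c c0 ->] /= H]|[c c0 ->]].
  exists c => //; rewrite lt_neqAle c0 andbT; apply/eqP => c00.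
  rewrite -c00 scale0r in H.
  have affS e : aff_hull S (e *: W0).
    exists 2%N, (fun i => if i == ord0 then 1 - e else e),
      (fun i => if i == ord0 then 0 else W0).
    split; first by rewrite !big_ord_recl big_ord0 /= addr0 subrK.
      move=> k; case: ifP => _; apply/SE; first by exists 0; rewrite ?scale0r.
      by exists 1; rewrite ?scale1r.
    by rewrite !big_ord_recl big_ord0 /= scaler0 add0r addr0.
  move: H; rewrite /within /= => /nbhs_ballP[e /= e0 H].
  (* [M] exceeds every entry of [W0] in absolute value, so [- (e / M) *: W0] lies in the entrywise
     ball of radius [e] around 0, yet on the wrong side of the line. *)
  pose M := 1 + \sum_a \sum_b `|W0 a b|.
  have M0 : 0 < M.
    by rewrite ltr_pwDl// sumr_ge0// => a _; rewrite sumr_ge0.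
  have eM : 0 < e / M by exact: divr_gt0.
  have : S ((- (e / M)) *: W0).
    apply: H (affS _); split=> // a b; rewrite !mxE.
    rewrite -ball_normE /= sub0r normrN normrM normrN.
    rewrite (gtr0_norm eM) mulrAC ltr_pdivrMr// ltr_pM2l//.
    rewrite /M (bigD1 a)//= (bigD1 b)//=.
    have h1 : 0 <= \sum_(k | k != b) `|W0 a k| by exact: sumr_ge0.
    have h2 : 0 <= \sum_(k | k != a) \sum_l `|W0 k l|.
      by apply: sumr_ge0 => *; exact: sumr_ge0.
    lra.
  move=> /SE[d d0 /matrixP/(_ i j)]; rewrite !mxE => /(mulIf Wij) de.
  lra.
split; first by apply/SE; exists c => //; exact: ltW.
have affS X : aff_hull S X -> exists d, X = d *: W0.
  move=> [k [a [Z [_ SZ ->]]]].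
  have ZE l : exists d, Z l = d *: W0 by have /SE[d _ ->] := SZ l; exists d.
  exists (\sum_l a l * (Z l i j / W0 i j)); rewrite scaler_suml.
  apply: eq_bigr => l _; have [d ->] := ZE l.
  by rewrite !mxE mulfK// scalerA.
rewrite /within /=; apply/nbhs_ballP.
(* With this radius, a nearby [d *: W0] has [|c - d| < c] by comparison of the entries at [i], [j],
   hence [d] is positive. *)
exists (c * `|W0 i j|) => /=; first by rewrite mulr_gt0 ?normr_gt0.
move=> X [_ HX] /affS[d Xd]; apply/SE; exists d => //.
have := HX i j; rewrite -ball_normE /= Xd !mxE -mulrBl normrM.
rewrite ltr_pM2r ?normr_gt0// => /ltr_normlP[_]; lra.
Qed.

Lemma mx_injP N k (V : 'M[R]_(N, k)) :
  row_free V^T <-> forall y : 'cV_k, V *m y = 0 -> y = 0.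
Proof.
split=> [fV y Vy|H].
  apply: trmx_inj; rewrite trmx0; apply: (row_free_inj fV).
  by rewrite mul0mx -trmx_mul Vy trmx0.
rewrite -kermx_eq0; apply/eqP/row_matrixP => i.
rewrite row0; apply: trmx_inj; rewrite trmx0; apply: H.
by rewrite -[V in V *m _]trmxK -trmx_mul -row_mul mulmx_ker row0 trmx0.
Qed.
End Generic.

(** * Kernels of rank one matrices and their sign bases *)

Section KernelBasis.
Variable R : realType.

Lemma rank1_mul_eq0 N (c : R) (v z : 'cV[R]_N) : c != 0 -> v != 0 ->
  (c *: (v *m v^T)) *m z = 0 <-> v^T *m z = 0.
Proof.
move=> c0 v0; rewrite -scalemxAl -mulmxA; split=> [|->]; last first.
  by rewrite mulmx0 scaler0.
have [i vi] : exists i, v i 0 != 0.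
  apply/not_existsP => H; move/eqP: v0; apply; apply/colP => i.
  by rewrite mxE; apply/eqP; apply: contrapT => /negP /H.
move=> /eqP; rewrite scaler_eq0 (negPf c0)/= => /eqP/matrixP/(_ i 0).
rewrite [LHS]mxE big_ord1 [RHS]mxE => /eqP; rewrite mulf_eq0 (negPf vi)/= => /eqP z0.
by exact/mx11_eq0.
Qed.

(** Passes from row spaces to column vectors, among which the kernel is the hyperplane orthogonal to
    [v]. *)
Lemma ker_basis_rank1 N k c (v : 'cV[R]_N) (V : 'M[R]_(N, k)) :
  c != 0 -> v != 0 ->
  ker_basis_mx (c *: (v *m v^T)) V <->
  (forall y : 'cV_k, V *m y = 0 -> y = 0) /\
  (forall z : 'cV_N, v^T *m z = 0 <-> exists y, z = V *m y).
Proof.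
move=> c0 v0; set W := c *: _.
have WE (z : 'cV_N) : W *m z = 0 <-> v^T *m z = 0 by exact: rank1_mul_eq0.
have kerE (z : 'cV_N) : (z^T <= kermx W^T)%MS <-> v^T *m z = 0.
  rewrite -WE; split=> [/sub_kermxP|Wz]; last first.
    by apply/sub_kermxP; rewrite -trmx_mul Wz trmx0.
  by rewrite -trmx_mul => Wz; apply: trmx_inj; rewrite Wz trmx0.
have imE (z : 'cV_N) : (z^T <= V^T)%MS <-> exists y, z = V *m y.
  split=> [/submxP[y zy]|[y ->]]; last by rewrite trmx_mul submxMl.
  by exists y^T; apply: trmx_inj; rewrite zy trmx_mul trmxK.
rewrite /ker_basis_mx mx_injP; split=> -[? H]; split=> //.
  move=> z; rewrite -imE -kerE.
  by split=> h; apply: submx_trans h _; case/andP: H.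
apply/andP; split; apply/rV_subP => u; rewrite -[u]trmxK.
  by move=> /imE/H/kerE.
by move=> /kerE/H/imE.
Qed.

(* Gaussian elimination of the pivot q: the columns are the unit vectors, the
   one indexed by the other support index of v being corrected by a multiple
   of the q-th one. *)
Lemma sign_kernel_basis N (v : 'cV[R]_N) (q : 'I_N) :
  (forall i, v i 0 \in [:: 0; 1; -1]) -> v q 0 != 0 ->
  (forall l l', l != q -> l' != q -> v l 0 != 0 -> v l' 0 != 0 -> l = l') ->
  exists k (V : 'M[R]_(N, k)),
    [/\ sign_entries V, disjoint_col_supports V,
        forall y : 'cV_k, V *m y = 0 -> y = 0 &
        forall z : 'cV_N, v^T *m z = 0 <-> exists y, z = V *m y].
Proof.
case: N v q => [v []//|N] v q sv vq v1.
have vv i : v i 0 != 0 -> v i 0 ^+ 2 = 1.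
  by have := sv i; rewrite !inE => /or3P[] /eqP->;
    rewrite ?eqxx ?sqrrN ?expr1n.
pose V := \matrix_(i < N.+1, j < N)
  (if i == q then - (v q 0 * v (lift q j) 0) else (i == lift q j)%:R : R).
have Vq j : V q j = - (v q 0 * v (lift q j) 0) by rewrite mxE eqxx.
have Vl i j : V (lift q i) j = (i == j)%:R.
  by rewrite mxE eq_sym (negPf (neq_lift _ _)) (inj_eq lift_inj).
have VyE (y : 'cV_N) i : (V *m y) (lift q i) 0 = y i 0.
  rewrite mxE (@sum_single _ _ _ i) => [|l li]; rewrite Vl ?eqxx ?mul1r//.
  by rewrite eq_sym (negPf li) mul0r.
exists N, V; split.
- move=> i j; have [i' ->|->] := unliftP q i.
    by rewrite Vl; case: eqP; rewrite !inE ?eqxx ?orbT.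
  rewrite Vq; have := sv q; have := sv (lift q j); rewrite !inE.
  by case/or3P=> /eqP->; case/or3P=> /eqP->;
    rewrite ?mulr0 ?mul0r ?mulr1 ?mulrN1 ?oppr0 ?opprK ?eqxx ?orbT.
- apply/disjoint_col_supportsP => i j j'.
  have [i' ->|->] := unliftP q i; last first.
    (* Row [q] meets column [j] only if [lift q j] is in the support of [v], and [v1] allows one
       such index. *)
    rewrite !Vq !oppr_eq0 !mulf_eq0 !(negPf vq)/= => vj vj'.
    by apply: (@lift_inj _ q); apply: v1 => //; rewrite eq_sym neq_lift.
  rewrite !Vl; case: (i' =P j) => [<- _|_]; last by rewrite eqxx.
  by case: (i' =P j') => [<-//|_]; rewrite eqxx.
- by move=> y Vy; apply/colP => i; rewrite -VyE Vy !mxE.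
move=> z; have vzE : (v^T *m z) 0 0
    = v q 0 * z q 0 + \sum_(j < N) v (lift q j) 0 * z (lift q j) 0.
  rewrite mxE (bigD1_ord q)//= mxE; congr (_ + _).
  by apply: eq_bigr => j _; rewrite mxE.
rewrite mx11_eq0 vzE; split=> [vz|[y zE]].
  exists (\col_j z (lift q j) 0); apply/colP => i.
  have [i' ->|->] := unliftP q i; first by rewrite VyE mxE.
  rewrite mxE; under eq_bigr do rewrite Vq mxE mulNr -mulrA.
  rewrite sumrN -mulr_sumr.
  have -> : \sum_i0 v (lift q i0) 0 * z (lift q i0) 0 = - (v q 0 * z q 0).
    by apply/eqP; rewrite -addr_eq0 addrC vz.
  by rewrite mulrN opprK mulrA -expr2 vv ?mul1r.
have -> : z q 0 = - (v q 0 * \sum_(j < N) v (lift q j) 0 * z (lift q j) 0).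
  rewrite zE mxE mulr_sumr -sumrN; apply: eq_bigr => j _.
  by rewrite Vq mulNr VyE mulrA.
by rewrite mulrN mulrA -expr2 vv// mul1r addNr.
Qed.
End KernelBasis.

(** * Explicit coordinates for the subspace after [t] steps *)

Section Canonical.
Variables (R : realType) (m : nat).
Local Notation n := (2 * m)%N.
Implicit Types (t k j : nat) (x y : 'cV[R]_n.+1) (Z X M : 'M[R]_n.+1).

(** Coordinates that parametrise [stage_space t]. For odd [t], coordinate [2 * t./2 + 2] is left
    out, being the opposite of the one before it. *)
Definition alive t k : bool :=
  (k == 0)%N || (2 * t./2 < k)%N && ~~ (odd t && (k == 2 * t./2 + 2)%N).

(** Given by equations, hence independent of the kernel bases chosen on the way. *)
Definition stage_space t : set 'cV[R]_n.+1 := [set x |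
  (forall r : 'I_n.+1, (0 < r <= 2 * t./2)%N -> x r 0 = 0) /\
  (odd t -> x (inord (2 * t./2 + 1)) 0 + x (inord (2 * t./2 + 2)) 0 = 0)].

Definition alive_mx t : 'M[R]_n.+1 :=
  \matrix_(r, c) ((r == c) && alive t r)%:R.

(* Restricting vectors of stage_space t to the alive coordinates is injective,
   and this matrix inverts the restriction. *)
Definition stage_mx t : 'M[R]_n.+1 :=
  \matrix_(r, c) (((r == c) && alive t r)%:R
    - [&& odd t, r == 2 * t./2 + 2 :> nat & c == 2 * t./2 + 1 :> nat]%N%:R).

(** This is zero for [k > n], which lets [exposing_even] include the last block. *)
Definition unit_vec k : 'cV[R]_n.+1 := \col_r (r == k :> nat)%:R.

Definition expose_vec t : 'cV[R]_n.+1 := \col_r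
  ((r == 2 * t./2 + 1 :> nat) || ~~ odd t && (r == 2 * t./2 + 2 :> nat))%N%:R.

(** The support of [q_j]; the condition [0 < k] drops index 0 when [j = 1], so that one formula
    serves all blocks. *)
Definition in_block j k : bool := (0 < k)%N && (2 * j - 2 <= k <= 2 * j)%N.

Definition block_vec j : 'cV[R]_n.+1 := \col_r (in_block j r)%:R.

Lemma qvec_block j : (1 <= j <= m)%N -> qvec R m j = block_vec j.
Proof.
move=> jm; apply/colP => r; rewrite /qvec /evec.
have dE k : (k <= n)%N ->
    (delta_mx (inord k) 0 : 'cV[R]_n.+1) r 0 = (r == k :> nat)%:R.
  by move=> kn; rewrite mxE eqxx andbT -val_eqE /= inordK.
case: eqP => [j1|j1]; rewrite !mxE -!val_eqE /= !inordK; try lia;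
rewrite !eqxx !andbT /in_block -?natrD; congr (_%:R); lia.
Qed.

Lemma LsetP X : Lset R m X <->
  [/\ X^T = X, X 0 0 = 1, forall i, i != 0 -> X i i = X 0 i
    & forall j, (1 <= j <= m)%N -> (block_vec j)^T *m X *m block_vec j = 0].
Proof.
have E j : (1 <= j <= m)%N -> mx_inner (qvec R m j *m (qvec R m j)^T) X = 0 <->
    (block_vec j)^T *m X *m block_vec j = 0.
  move=> jm; rewrite qvec_block// mx_inner_rank1; split=> [h|->].
    by apply/matrixP => a b; rewrite !ord1 h mxE.
  by rewrite mxE.
by split=> -[h1 h2 h3 h4]; split=> // j jm; apply/E => //; exact: h4.
Qed.

Lemma mul_unit_vec p (A : 'M[R]_(p, n.+1)) k r : (k <= n)%N ->
  (A *m unit_vec k) r 0 = A r (inord k).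
Proof.
move=> kn; rewrite mxE (@sum_single _ _ _ (inord k)) => [|l lk].
  by rewrite mxE inordK// eqxx mulr1.
rewrite mxE; case: eqP => [e|]; rewrite ?mulr0//.
by move: lk; rewrite -e inord_val eqxx.
Qed.

Lemma mul_stage_mx t x r : (t <= n)%N ->
  (stage_mx t *m x) r 0 = (alive t r)%:R * x r 0
    - (odd t && (r == 2 * t./2 + 2 :> nat))%N%:R * x (inord (2 * t./2 + 1)) 0.
Proof.
move=> tn; rewrite mxE; under eq_bigr do rewrite mxE mulrBl.
rewrite sumrB; congr (_ - _).
  rewrite (@sum_single _ _ _ r) ?eqxx// => l lr.
  by rewrite eq_sym (negPf lr) mul0r.
have [ot|] := boolP (odd t); last first.
  by move=> _; rewrite big1 ?mul0r// => *; rewrite mul0r.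
have tb : (2 * t./2 + 1 <= n)%N by lia.
rewrite (@sum_single _ _ _ (inord (2 * t./2 + 1)))/= ?inordK ?eqxx ?andbT// => l lr.
case: (l =P _ :> nat) => [e|]; last by rewrite andbF mul0r.
by move: lr; rewrite -e inord_val eqxx.
Qed.

(** Together with [stage_mx_in], this makes [stage_mx t] a projection onto [stage_space t]. *)
Lemma stage_mx_id t x : (t <= n)%N -> stage_space t x -> stage_mx t *m x = x.
Proof.
move=> tn [x0 xo]; apply/colP => r; rewrite mul_stage_mx//.
have rE : r = inord r by rewrite inord_val.
have [ar|] := boolP (alive t r).
  rewrite mul1r (_ : _ && _ = false) ?mul0r ?subr0//.
  by move: ar; rewrite /alive; lia.
rewrite mul0r sub0r => ar.
have [/andP[ot /eqP e]|ne] := boolP (odd t && _).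
  by rewrite rE e mul1r; apply/eqP; rewrite eq_sym -addr_eq0 addrC xo.
by rewrite mul0r oppr0 x0//; move: ar ne; rewrite /alive; lia.
Qed.

Lemma stage_mx_in t x : (t <= n)%N -> stage_space t (stage_mx t *m x).
Proof.
move=> tn; have E r := mul_stage_mx x r tn.
split=> [r rt|ot]; rewrite !E.
  have -> : alive t r = false by move: rt; rewrite /alive; lia.
  have -> : (odd t && (r == 2 * t./2 + 2 :> nat))%N = false by move: rt; lia.
  by rewrite !mul0r subr0.
rewrite ot !inordK; try lia.
have -> : alive t (2 * t./2 + 1) by rewrite /alive; lia.
have -> : alive t (2 * t./2 + 2) = false by rewrite /alive ot eqxx andbF; lia.
have -> : (2 * t./2 + 1 == 2 * t./2 + 2)%N = false by lia.
by rewrite eqxx !mul0r !mul1r sub0r subr0 subrr.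
Qed.

Lemma mul_alive_mx t k (U : 'M[R]_(n.+1, k)) r l :
  (alive_mx t *m U) r l = (alive t r)%:R * U r l.
Proof.
rewrite mxE (@sum_single _ _ _ r) => [|i ir]; rewrite mxE ?eqxx//.
by rewrite eq_sym (negPf ir) mul0r.
Qed.

Lemma stage_alive_mx t : (t <= n)%N -> stage_mx t *m alive_mx t = stage_mx t.
Proof.
move=> tn; apply/matrixP => r c; rewrite mxE (@sum_single _ _ _ c) => [|i ic].
  rewrite [alive_mx _ _ _]mxE eqxx/=.
  have [|ac] := boolP (alive t c); first by rewrite mulr1.
  rewrite mulr0 mxE; have [e|] := eqVneq r c.
    rewrite -e in ac *; rewrite (negPf ac) (_ : [&& _, _ & _] = false) ?subr0//.
    by lia.
  rewrite (_ : [&& _, _ & _] = false) ?subr0//.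
  by move: ac; rewrite /alive; lia.
by rewrite [alive_mx _ _ _]mxE (negPf ic) mulr0.
Qed.

Lemma stage_spaceB t x y :
  stage_space t x -> stage_space t y -> stage_space t (x - y).
Proof.
move=> [x0 xo] [y0 yo]; split=> [r rt|ot].
  by rewrite !mxE x0// y0// subrr.
by rewrite !mxE addrACA -opprD xo// yo// subrr.
Qed.

Lemma stage_space_unit t k : (t <= n)%N -> alive t k ->
  ~~ (odd t && (k == 2 * t./2 + 1)%N) -> stage_space t (unit_vec k).
Proof.
move=> tn ak nk; split=> [r rt|ot]; rewrite !mxE.
  suff -> : (r == k :> nat) = false by [].
  by move: ak rt; rewrite /alive; lia.
rewrite !inordK; try lia.
have -> : (2 * t./2 + 1 == k)%N = false by move: ak nk; rewrite /alive; lia.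
have -> : (2 * t./2 + 2 == k)%N = false by move: ak nk; rewrite /alive; lia.
by rewrite addr0.
Qed.

(** For even [t] the new equation is [x_a + x_b = 0]. For odd [t] it is [x_a = 0], which then forces
    [x_b = 0] as well, and [t./2] goes up by one. *)
Lemma stage_space_step t x : (t < n)%N ->
  stage_space t.+1 x <->
  stage_space t x /\ (expose_vec t)^T *m x = 0.
Proof.
move=> tn.
have wE : ((expose_vec t)^T *m x = 0) <-> x (inord (2 * t./2 + 1)) 0
     + (~~ odd t)%:R * x (inord (2 * t./2 + 2)) 0 = 0.
  have -> : expose_vec t = unit_vec (2 * t./2 + 1)
      + (~~ odd t)%:R *: unit_vec (2 * t./2 + 2).
    apply/colP => r; rewrite !mxE -natrM mulnb -natrD; congr (_%:R); lia.
  rewrite mx11_eq0 dot_mxC mulmxDr -scalemxAr [LHS]mxE mul_unit_vec; last by lia.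
  by rewrite [X in _ + X]mxE mul_unit_vec ?[x^T _ _]mxE; last by lia.
rewrite wE; have [ot|ot] := boolP (odd t).
  have sE : uphalf t = (t./2).+1 by rewrite uphalf_half ot.
  rewrite /stage_space /= sE ot /= mul0r addr0; split.
    move=> [x0 _]; split; [split=> [r rt|_]|].
    - by apply: x0; lia.
    - by rewrite !x0 ?addr0// inordK; lia.
    - by rewrite x0// inordK; lia.
  move=> [[x0 /(_ isT) xo] xa]; split=> // r rt.
  rewrite -[r]inord_val; have [|] := boolP (r <= 2 * t./2)%N.
    by move=> ?; rewrite inord_val x0//; lia.
  have [-> //|ra rs] := eqVneq (r : nat) (2 * t./2 + 1)%N.
  have -> : (r : nat) = (2 * t./2 + 2)%N by lia.
  by move: xo; rewrite xa add0r.
have sE : uphalf t = t./2 by rewrite uphalf_half (negPf ot).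
rewrite /stage_space /= sE (negPf ot) /= mul1r; split; first by case=> h /(_ isT) ->.
by case=> [[h _] ?].
Qed.

End Canonical.

(** * Linear relations between the entries of an exposing matrix *)

Section Exposing.
Variables (R : realType) (m : nat).
Local Notation n := (2 * m)%N.
Local Notation unit_vec := (@unit_vec R m).
Local Notation block_vec := (@block_vec R m).
Local Notation stage_mx := (@stage_mx R m).
Local Notation expose_vec := (@expose_vec R m).
Implicit Types (t k j : nat) (x y : 'cV[R]_n.+1) (Z X M : 'M[R]_n.+1).

(** The exposing matrices of stage [t] in the original coordinates: [Z] is tested only on the
    members of [Lset] that are fixed under congruence by the projection. *)
Definition exposing t Z : Prop :=
  [/\ DD R _ Z, forall r c : 'I_n.+1, ~~ alive t r -> Z r c = 0
    & forall X, Lset R m X -> stage_mx t *m X *m (stage_mx t)^T = X ->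
        mx_inner Z X = 0].

Lemma stage_mx_congr t x y : (t <= n)%N ->
  stage_space t x -> stage_space t y ->
  stage_mx t *m (x *m y^T) *m (stage_mx t)^T = x *m y^T.
Proof.
move=> tn sx sy.
by rewrite mulmxA -mulmxA -trmx_mul !stage_mx_id.
Qed.

Lemma block_unit j k : (j <= m)%N ->
  ((block_vec j)^T *m unit_vec k) 0 0 = (in_block j k)%:R.
Proof.
move=> jm; have [kn|kn] := leqP k n.
  by rewrite mul_unit_vec// !mxE inordK.
rewrite mxE big1 => [|r _].
  by suff -> : in_block j k = false by []; rewrite /in_block; lia.
rewrite !mxE (_ : (r == k :> nat) = false) ?mulr0//.
by apply/negP => /eqP e; have := ltn_ord r; rewrite e; lia.
Qed.

Lemma quad_rank1 (q x y : 'cV[R]_n.+1) :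
  (q^T *m (x *m y^T) *m q) 0 0 = (q^T *m x) 0 0 * (q^T *m y) 0 0.
Proof.
by rewrite mulmxA -mulmxA mxE big_ord1 (dot_mxC q y).
Qed.

Lemma exposing_sym t Z (r c : 'I_n.+1) : exposing t Z -> Z r c = Z c r.
Proof. by move=> [[symZ _] _ _]; rewrite -[in LHS]symZ mxE. Qed.

Lemma exposing_row t Z (r : 'I_n.+1) : exposing t Z -> Z r r = 0 -> forall c, Z r c = 0.
Proof.
move=> [ddZ _ _] Zr c; apply/eqP; rewrite -normr_le0 -Zr.
exact: DD_entry.
Qed.

Lemma stage_space_unit0 t : (t <= n)%N -> stage_space t (unit_vec 0).
Proof. by move=> tn; apply: stage_space_unit => //; apply/negP; lia. Qed.

Lemma unit_vecE k (r : 'I_n.+1) : unit_vec k r 0 = (r == k :> nat)%:R.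
Proof. by rewrite mxE. Qed.

(** The matrix [e_0 e_0^T] belongs to [Lset], so [Z_00 = 0], and dominance kills the row. *)
Lemma exposing_row0 t Z : (t <= n)%N -> exposing t Z -> forall c, Z 0 c = 0.
Proof.
move=> tn eZ; apply: (exposing_row eZ); have [_ _ tZ] := eZ.
have s0 := stage_space_unit0 tn.
have := tZ (unit_vec 0 *m (unit_vec 0)^T).
rewrite mx_inner_rank1r mul_unit_vec// mxE.
under eq_bigr do rewrite mxE unit_vecE.
rewrite (@sum_single _ _ _ 0) => [|l l0]; last first.
  by rewrite (_ : (l == 0%N :> nat) = false) ?mul0r//; apply/negbTE.
rewrite mul1r (_ : inord 0 = 0); last by apply: val_inj; rewrite /= inordK.
apply; last exact: stage_mx_congr.
apply/LsetP; split.
- by rewrite trmx_mul trmxK.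
- by rewrite mxE big_ord1 !mxE mul1r.
- move=> i i0; rewrite !mxE !big_ord1 !mxE.
  by rewrite (_ : (i == 0%N :> nat) = false) ?mulr0//; apply/negbTE.
move=> j jm; apply/mx11_eq0; rewrite quad_rank1 block_unit; last by lia.
by rewrite mul0r.
Qed.

(* The diagonal constraints Y_ii = Y_0i of Lset are free: the zeroth row of Z
   vanishes, so the zeroth row of a test matrix can be chosen at will. *)
Lemma exposing_test t Z M : (t <= n)%N -> exposing t Z ->
  M^T = M -> (forall c, M 0 c = 0) ->
  stage_mx t *m M *m (stage_mx t)^T = M ->
  stage_space t (\col_r M r r) ->
  (forall j, (1 <= j <= m)%N -> ((block_vec j)^T *m M *m block_vec j) 0 0 = 0) ->
  mx_inner Z M = 0.
Proof.
move=> tn eZ symM M0 PM sd qM; set d := \col_r M r r in sd.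
have s0 := stage_space_unit0 tn.
have Z0 := exposing_row0 tn eZ; have [[symZ _] _ tZ] := eZ.
have i0 : (inord 0 : 'I_n.+1) = 0 by apply: val_inj; rewrite /= inordK.
have Ze0 : Z *m unit_vec 0 = 0.
  by apply/colP => r; rewrite mul_unit_vec// i0 (exposing_sym _ _ eZ) Z0 mxE.
have e0Z : (unit_vec 0)^T *m Z = 0.
  by apply: trmx_inj; rewrite trmx_mul trmxK symZ Ze0 trmx0.
(* The added terms make [X_00 = 1] and [X_0i = M_ii]. Each has a factor [unit_vec 0], which [Z]
   annihilates and which is orthogonal to every block. *)
pose X := M + unit_vec 0 *m (unit_vec 0)^T + unit_vec 0 *m d^T
  + d *m (unit_vec 0)^T.
have addE (A B : 'M[R]_n.+1) : mx_inner Z (A + B) = mx_inner Z A + mx_inner Z B.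
  by rewrite /mx_inner mulmxDr mxtraceD.
have <- : mx_inner Z X = mx_inner Z M.
  rewrite !addE !mx_inner_rank1r e0Z -mulmxA Ze0.
  by rewrite !mul0mx mulmx0 [X in _ + X]mxE !mxE !addr0.
have XE r c : X r c = M r c + (r == 0)%:R * (c == 0)%:R
    + (r == 0)%:R * M c c + M r r * (c == 0)%:R.
  by rewrite !mxE !big_ord1 !mxE.
apply: tZ; last first.
  by rewrite /X !mulmxDr !mulmxDl PM !stage_mx_congr.
apply/LsetP; split.
- rewrite /X !linearD /= !trmx_mul !trmxK symM -!addrA; congr (_ + (_ + _)).
  exact: addrC.
- by rewrite XE !M0 eqxx !mulr0 !mul0r !addr0 add0r mul1r.
- move=> i ni; rewrite !XE !M0 (negPf ni) eqxx.
  by rewrite !mul0r !mulr0 !mul1r !addr0 !add0r.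
move=> j jm; apply/mx11_eq0.
rewrite /X !mulmxDr !mulmxDl 3![_ 0 0]mxE qM// add0r !quad_rank1.
rewrite block_unit; last by lia.
by rewrite !mul0r mulr0 !addr0.
Qed.

Lemma in_block_odd j l : (1 <= j)%N -> in_block l (2 * j - 1) = (l == j).
Proof. by move=> j1; rewrite /in_block; lia. Qed.

(* The coordinate 2j - 1 occurs in the j-th block only. *)
Lemma exposing_pivot t Z j y : (t <= n)%N -> exposing t Z ->
  (1 <= j <= m)%N ->
  stage_space t (unit_vec (2 * j - 1)) -> stage_space t y ->
  y 0 0 = 0 -> y (inord (2 * j - 1)) 0 = 0 ->
  ((block_vec j)^T *m y) 0 0 = 1 ->
  Z (inord (2 * j - 1)) (inord (2 * j - 1)) = (Z *m y) (inord (2 * j - 1)) 0.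
Proof.
move=> tn eZ jm su sy y0 yi qy; have [[symZ _] _ _] := eZ.
set u := unit_vec _ in su *; set z := u - y.
have in_n : (2 * j - 1 <= n)%N by lia.
have sz : stage_space t z by exact: stage_spaceB.
have u0 : u 0 0 = 0.
  by rewrite unit_vecE (_ : _ == _ = false)//; apply/negbTE; rewrite /=; lia.
have z0 : z 0 0 = 0 by rewrite !mxE y0 subr0 -[RHS]u0 mxE.
(* This test matrix satisfies the block constraints: [u] is orthogonal to every block but the
   [j]-th, and [z] is orthogonal to that one. *)
have := exposing_test (M := u *m z^T + z *m u^T) tn eZ.
have -> : mx_inner Z (u *m z^T + z *m u^T) = 2 * (u^T *m Z *m z) 0 0.
  rewrite /mx_inner mulmxDr mxtraceD -!/(mx_inner _ _) !mx_inner_rank1r.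
  by rewrite -mulmxA dot_mxC trmx_mul symZ mulr2n mulrDl !mul1r.
have -> : (u^T *m Z *m z) 0 0
    = Z (inord (2 * j - 1)) (inord (2 * j - 1)) - (Z *m y) (inord (2 * j - 1)) 0.
  rewrite -mulmxA dot_mxC mul_unit_vec// mxE /z mulmxBr mxE mul_unit_vec//.
  by rewrite [X in _ + X]mxE.
move=> H; suff : 2 * (Z (inord (2 * j - 1)) (inord (2 * j - 1))
    - (Z *m y) (inord (2 * j - 1)) 0) = 0 by lra.
have ME r c : (u *m z^T + z *m u^T) r c = u r 0 * z c 0 + z r 0 * u c 0.
  by rewrite !mxE !big_ord1 !mxE.
apply: H.
- by rewrite linearD /= !trmx_mul !trmxK addrC.
- by move=> c; rewrite ME u0 z0 !mul0r addr0.
- by rewrite mulmxDr mulmxDl !stage_mx_congr.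
(* Since [y] vanishes at the pivot, [z] equals 1 there, and the diagonal is twice [u]. *)
- suff -> : \col_r (u *m z^T + z *m u^T) r r = u + u.
    rewrite -[X in _ + X]opprK; apply: stage_spaceB => //.
    rewrite -[- u]add0r; apply: stage_spaceB => //.
    by rewrite -(subrr u); apply: stage_spaceB.
  apply/colP => r; rewrite mxE ME [RHS]mxE.
  have [->|ri] := eqVneq r (inord (2 * j - 1)).
    have ui : u (inord (2 * j - 1)) 0 = 1 by rewrite unit_vecE inordK// eqxx.
    by rewrite [z _ _]mxE [(- y) _ _]mxE yi ui subr0 mulr1.
  have -> : u r 0 = 0.
    rewrite unit_vecE (_ : _ == _ = false)//; apply/eqP => e.
    by move: ri; rewrite -e inord_val eqxx.
  by rewrite mul0r mulr0.
move=> l lm; rewrite mulmxDr mulmxDl mxE !quad_rank1 block_unit; last by lia.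
rewrite in_block_odd; last by lia.
have [->|] := eqVneq l j; last by rewrite mul0r mulr0 addr0.
suff -> : ((block_vec j)^T *m z) 0 0 = 0 by rewrite mulr0 mul0r addr0.
rewrite /z mulmxBr mxE block_unit; last by lia.
by rewrite [X in _ + X]mxE qy in_block_odd ?eqxx ?subrr//; lia.
Qed.

Definition unit_diag k : 'M[R]_n.+1 := unit_vec k *m (unit_vec k)^T.

Lemma mx_inner_unit_diag Z k : (k <= n)%N ->
  mx_inner Z (unit_diag k) = Z (inord k) (inord k).
Proof.
move=> kn; rewrite mx_inner_rank1r -mulmxA dot_mxC mul_unit_vec// mxE.
by rewrite mul_unit_vec.
Qed.

Lemma unit_diag_oob k : (n < k)%N -> unit_diag k = 0.
Proof.
move=> kn; suff -> : unit_diag k = 0 *m (unit_vec k)^T by rewrite mul0mx.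
rewrite /unit_diag; congr (_ *m _); apply/colP => r; rewrite !mxE.
by rewrite (_ : _ == _ = false)//; apply/negbTE; have := ltn_ord r; lia.
Qed.

(* The coordinate 2j occurs in the blocks j and j + 1. *)
Lemma exposing_even t Z j : (t <= n)%N -> exposing t Z ->
  (1 <= j <= m)%N -> (t.+1 < 2 * j)%N ->
  Z (inord (2 * j)) (inord (2 * j)) = Z (inord (2 * j - 1)) (inord (2 * j - 1))
    + mx_inner Z (unit_diag (2 * j + 1)).
Proof.
move=> tn eZ jm tj.
(* For odd [t] the coordinates [2 * t./2 + 1] and [2 * t./2 + 2] are [t] and [t.+1], so above [t]
   only [t.+1] has to be avoided. *)
have su k : (t < k)%N -> ~~ (odd t && (k == t.+1)) -> stage_space t (unit_vec k).
  by move=> tk ok; apply: stage_space_unit => //; move: ok; rewrite /alive; lia.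
have [ji s2] : stage_space t (unit_vec (2 * j - 1)) /\ stage_space t (unit_vec (2 * j)).
  split; apply: su; lia.
have s3 : stage_space t (unit_vec (2 * j + 1)) by apply: su; lia.
set D1 := unit_diag (2 * j + 1).
rewrite -!mx_inner_unit_diag; try lia.
have BE (A B : 'M[R]_n.+1) : mx_inner Z (A - B) = mx_inner Z A - mx_inner Z B.
  by rewrite /mx_inner mulmxBr linearB.
apply/eqP; rewrite -subr_eq0 opprD addrA -!BE; apply/eqP.
(* The test matrix is [E_{2j} - E_{2j-1} - E_{2j+1}] with diagonal units [E]: a block that meets it
   sees one plus and one minus sign. *)
apply: (exposing_test tn eZ).
- by rewrite !linearB /= !trmx_mul !trmxK.
- move=> c; rewrite !mxE !big_ord1 !mxE /=.
  have -> : (0 == 2 * j)%N = false by lia.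
  have -> : (0 == 2 * j - 1)%N = false by lia.
  have -> : (0 == 2 * j + 1)%N = false by lia.
  by rewrite !mul0r !subr0.
- by rewrite !mulmxBr !mulmxBl !stage_mx_congr.
- suff -> : \col_r (unit_diag (2 * j) - unit_diag (2 * j - 1) - D1) r r
      = unit_vec (2 * j) - unit_vec (2 * j - 1) - unit_vec (2 * j + 1).
    by do 2!apply: stage_spaceB => //.
  apply/colP => r; rewrite !mxE !big_ord1 !mxE.
  by do 3!case: eqP => _; rewrite ?mulr0 ?mulr1.
move=> l lm; rewrite !mulmxBr !mulmxBl.
have sub00 (A B : 'M[R]_1) : (A - B) 0 0 = A 0 0 - B 0 0 by rewrite !mxE.
rewrite !sub00 !quad_rank1.
rewrite !block_unit; try lia.
have -> : in_block l (2 * j) = (l == j) || (l == j.+1) by rewrite /in_block; lia.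
have -> : in_block l (2 * j - 1) = (l == j) by rewrite /in_block; lia.
have -> : in_block l (2 * j + 1) = (l == j.+1) by rewrite /in_block; lia.
have [->|_] := eqVneq l j.
  by rewrite (_ : j == j.+1 = false) ?mulr0 ?mulr1 ?subrr ?subr0//; lia.
by case: eqP => _ /=; rewrite ?mulr0 ?mulr1 ?subrr ?subr0 ?subrr.
Qed.

End Exposing.

(** * Every exposing matrix of a stage lies on one ray *)

Section Stages.
Variables (R : realType) (m : nat).
Local Notation n := (2 * m)%N.
Local Notation unit_vec := (@unit_vec R m).
Local Notation block_vec := (@block_vec R m).
Local Notation stage_mx := (@stage_mx R m).
Local Notation alive_mx := (@alive_mx R m).
Local Notation expose_vec := (@expose_vec R m).
Implicit Types (t k j : nat) (x y : 'cV[R]_n.+1) (Z X M : 'M[R]_n.+1).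

(** Row [i = 2j - 1] has two off-diagonal entries of absolute value [|Z_ii|], so dominance yields
    [2 |Z_ii| <= Z_ii]. *)
Lemma exposing_late_odd t Z j : (t <= n)%N -> exposing t Z ->
  (t./2 + 2 <= j <= m)%N -> Z (inord (2 * j - 1)) (inord (2 * j - 1)) = 0.
Proof.
move=> tn eZ jm; have [ddZ deadZ _] := eZ; set i := inord _.
have j1 : (1 <= j <= m)%N by lia.
have si : stage_space t (unit_vec (2 * j - 1)).
  by apply: stage_space_unit => //; rewrite ?/alive; lia.
have inordE a b : (a <= n)%N -> (b <= n)%N ->
    ((inord a : 'I_n.+1) == inord b) = (a == b).
  by move=> an bn; rewrite -val_eqE /= !inordK.
have unitE a b : (a <= n)%N -> unit_vec b (inord a) 0 = (a == b)%:R.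
  by move=> an; rewrite unit_vecE inordK.
have unit0 b : unit_vec b 0 0 = (0 == b)%N%:R by rewrite unit_vecE.
have Z1 : Z i i = Z i (inord (2 * j)).
  rewrite -[RHS]mul_unit_vec; last by lia.
  apply: (exposing_pivot tn eZ) => //.
  - by apply: stage_space_unit => //; rewrite ?/alive; lia.
  - by rewrite unit0; have -> : (0 == 2 * j)%N = false by lia.
  - by rewrite unitE; [have -> : (2 * j - 1 == 2 * j)%N = false by lia | lia].
  rewrite block_unit; last by lia.
  by have -> : in_block j (2 * j) = true by rewrite /in_block; lia.
have [k [kn ki kj Z2]] : exists k, [/\ (k <= n)%N, k != (2 * j - 1)%N,
    k != (2 * j)%N & `|Z i i| = `|Z i (inord k)| ].
  (* For odd [t] the first such block has its index [2j - 2 = b] dead, so [e_b - e_a] replaces the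
     unit vector. The entry of [Z] at [b] is zero, which leaves minus the entry at [a]. *)
  have [/andP[ot /eqP je]|ne] := boolP (odd t && (j == t./2 + 2)).
    exists (2 * t./2 + 1)%N; split; try lia.
    set y := unit_vec (2 * t./2 + 2) - unit_vec (2 * t./2 + 1).
    have -> : Z i i = (Z *m y) i 0.
      apply: (exposing_pivot tn eZ) => //.
      - split=> [r rt|_].
          rewrite !mxE.
          have -> : (r == 2 * t./2 + 2 :> nat)%N = false by lia.
          have -> : (r == 2 * t./2 + 1 :> nat)%N = false by lia.
          by rewrite subrr.
        rewrite !mxE !inordK; try lia.
        have -> : (2 * t./2 + 1 == 2 * t./2 + 2)%N = false by lia.
        have -> : (2 * t./2 + 2 == 2 * t./2 + 1)%N = false by lia.
        by rewrite !eqxx sub0r subr0 addNr.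
      - rewrite !mxE /=.
        have -> : (0 == 2 * t./2 + 2)%N = false by lia.
        have -> : (0 == 2 * t./2 + 1)%N = false by lia.
        by rewrite subrr.
      - rewrite !mxE !inordK; try lia.
        have -> : (2 * j - 1 == 2 * t./2 + 2)%N = false by lia.
        have -> : (2 * j - 1 == 2 * t./2 + 1)%N = false by lia.
        by rewrite subrr.
      rewrite mulmxBr mxE [X in _ + X]mxE !block_unit; try lia.
      have -> : in_block j (2 * t./2 + 2) = true by rewrite /in_block; lia.
      have -> : in_block j (2 * t./2 + 1) = false by rewrite /in_block; lia.
      by rewrite subr0.
    rewrite mulmxBr mxE [X in _ + X]mxE !mul_unit_vec; try lia.
    rewrite (exposing_sym _ _ eZ) deadZ; last first.
      rewrite inordK; last by lia.
      by rewrite /alive; lia.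
    by rewrite sub0r normrN.
  exists (2 * j - 2)%N; split; try lia.
  congr `| _ |; rewrite -[RHS]mul_unit_vec; last by lia.
  apply: (exposing_pivot tn eZ) => //.
  - by apply: stage_space_unit => //; move: ne; rewrite ?/alive; lia.
  - by rewrite unit0; have -> : (0 == 2 * j - 2)%N = false by lia.
  - by rewrite unitE; [have -> : (2 * j - 1 == 2 * j - 2)%N = false by lia | lia].
  rewrite block_unit; last by lia.
  by have -> : in_block j (2 * j - 2) = true by rewrite /in_block; lia.
have : `|Z i (inord (2 * j))| + `|Z i (inord k)| <= Z i i.
  apply: DD_two_entries => //; rewrite /i inordE //; lia.
rewrite -Z1 -Z2; have := ler_norm (Z i i); have := normr_ge0 (Z i i); lra.
Qed.

(** For even [r], [exposing_even] writes [Z_rr] as the sum of the diagonal entries at its odd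
    neighbours, which vanish; the upper neighbour is absent when [r = n]. *)
Lemma exposing_late t Z (r : 'I_n.+1) : (t <= n)%N -> exposing t Z ->
  (2 * t./2 + 3 <= r)%N -> forall c, Z r c = 0.
Proof.
move=> tn eZ tr; apply: (exposing_row eZ); rewrite -[r]inord_val.
have := ltn_ord r; rewrite ltnS => rn.
have [ro|re] := boolP (odd r).
  have -> : r = (2 * (r./2 + 1) - 1)%N :> nat by lia.
  by apply: (exposing_late_odd tn eZ); lia.
have -> : r = (2 * r./2)%N :> nat by lia.
rewrite (exposing_even tn eZ); try lia.
rewrite (exposing_late_odd tn eZ); last by lia.
have [rm|rm] := leqP (2 * r./2 + 1) n.
  rewrite mx_inner_unit_diag//.
  have -> : (2 * r./2 + 1 = 2 * (r./2 + 1) - 1)%N by lia.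
  by rewrite (exposing_late_odd tn eZ) ?addr0//; lia.
by rewrite unit_diag_oob// /mx_inner mulmx0 mxtrace0 addr0.
Qed.

Lemma exposing_ray t Z : (t <= n)%N -> exposing t Z ->
  exists2 c, 0 <= c & Z = c *: (expose_vec t *m (expose_vec t)^T).
Proof.
move=> tn eZ; have [ddZ deadZ _] := eZ.
(* For [t = n] the index is out of range and [inord] falls back to 0; [expose_vec n] is then zero,
   so any nonnegative coefficient serves. *)
pose ia : 'I_n.+1 := inord (2 * t./2 + 1).
exists (Z ia ia); first by apply: le_trans (DD_entry ia ia ddZ).
have row0 (r c : 'I_n.+1) : expose_vec t r 0 = 0 -> Z r c = 0.
  rewrite mxE; case: eqP => [_|ra] /=; first by move/eqP; rewrite oner_eq0.
  have [ar|/deadZ//] := boolP (alive t r).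
  case: andP => [_|rb _]; first by move/eqP; rewrite oner_eq0.
  have [r3|r3] := leqP (2 * t./2 + 3) r; first exact: (exposing_late tn eZ).
  suff -> : r = 0 by exact: (exposing_row0 tn eZ).
  by apply: val_inj => /=; move: ar; rewrite /alive; lia.
apply/matrixP => r c; rewrite !mxE big_ord1 [_^T _ _]mxE.
have [r0|] := eqVneq (expose_vec t r 0) 0; first by rewrite r0 row0// mul0r mulr0.
have [c0|] := eqVneq (expose_vec t c 0) 0.
  by rewrite c0 (exposing_sym _ _ eZ) row0// !mulr0.
rewrite ![expose_vec _ _ _]mxE.
case: orP => [cE _|]; last by rewrite eqxx.
case: orP => [rE _|]; last by rewrite eqxx.
rewrite !mulr1.
have rN := ltn_ord r; have cN := ltn_ord c.
have [ot|et] := boolP (odd t).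
  have -> : r = ia by apply: val_inj; rewrite /= inordK; lia.
  by have -> : c = ia by apply: val_inj; rewrite /= inordK; lia.
(* The nonzero entry of [expose_vec t] at [r] excludes [t = n]. *)
have tm : (t./2 < m)%N by lia.
pose ib : 'I_n.+1 := inord (2 * t./2 + 2).
have iaE : (2 * (t./2 + 1) - 1 = 2 * t./2 + 1)%N by lia.
have ibE : (2 * (t./2 + 1) = 2 * t./2 + 2)%N by lia.
have Zab : Z ia ia = Z ia ib.
  rewrite -[RHS]mul_unit_vec; last by lia.
  rewrite /ia -iaE; apply: (exposing_pivot tn eZ) => //; try lia.
  - by apply: stage_space_unit => //; rewrite ?/alive; lia.
  - by apply: stage_space_unit => //; rewrite ?/alive; lia.
  - by rewrite unit_vecE /=; have -> : (0 == 2 * t./2 + 2)%N = false by lia.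
  - rewrite unit_vecE inordK; last by lia.
    by have -> : (2 * (t./2 + 1) - 1 == 2 * t./2 + 2)%N = false by lia.
  rewrite block_unit; last by lia.
  by have -> : in_block (t./2 + 1) (2 * t./2 + 2) = true by rewrite /in_block; lia.
(* The upper neighbour of [b] is a late row or exceeds [n], so it contributes nothing. *)
have Zbb : Z ib ib = Z ia ia.
  have jm : (1 <= t./2 + 1 <= m)%N by lia.
  have tj : (t.+1 < 2 * (t./2 + 1))%N by lia.
  have := exposing_even tn eZ jm tj; rewrite iaE ibE -/ia -/ib => ->.
  have [rm|rm] := leqP (2 * (t./2 + 1) + 1) n.
    rewrite -ibE mx_inner_unit_diag// [X in _ + X](exposing_late tn eZ).
      by rewrite addr0.
    by rewrite inordK; lia.
  by rewrite -ibE unit_diag_oob// /mx_inner mulmx0 mxtrace0 addr0.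
have abE (i : 'I_n.+1) : (i == 2 * t./2 + 1 :> nat)%N \/
    ~~ odd t && (i == 2 * t./2 + 2 :> nat)%N -> i = ia \/ i = ib.
  by case=> [/eqP e|/andP[_ /eqP e]]; [left|right];
    apply: val_inj; rewrite /= inordK; lia.
by case: (abE _ rE) => ->; case: (abE _ cE) => -> //;
  rewrite (exposing_sym _ _ eZ).
Qed.

End Stages.

(** * Running the reduction with arbitrary kernel bases *)

Section Reduction.
Variables (R : realType) (m : nat).
Local Notation n := (2 * m)%N.
Local Notation unit_vec := (@unit_vec R m).
Local Notation block_vec := (@block_vec R m).
Local Notation stage_mx := (@stage_mx R m).
Local Notation alive_mx := (@alive_mx R m).
Local Notation expose_vec := (@expose_vec R m).

(* U is the product of the kernel bases chosen in the first t steps. *)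
Definition stage_basis t k (U : 'M[R]_(n.+1, k)) : Prop :=
  [/\ sign_entries U, disjoint_col_supports U,
      forall y : 'cV_k, U *m y = 0 -> y = 0
    & forall x : 'cV_n.+1, stage_space t x <-> exists y, x = U *m y].

Lemma expose_vec_alive t (r : 'I_n.+1) : expose_vec t r 0 != 0 -> alive t r.
Proof.
rewrite mxE; case: (_ || _) / orP => [h _|]; last by rewrite eqxx.
move: h; rewrite /alive; lia.
Qed.

Lemma sum_unit_vec_le1 k : \sum_r unit_vec k r 0 <= 1.
Proof.
have [kn|kn] := leqP k n.
  rewrite (@sum_single _ _ _ (inord k)) ?unit_vecE ?inordK ?eqxx// => r rk.
  rewrite unit_vecE; case: eqP => // e.
  by move: rk; rewrite -e inord_val eqxx.
rewrite big1 ?ler01// => r _; rewrite unit_vecE; case: eqP => // e.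
by have := ltn_ord r; rewrite e; lia.
Qed.

(** The 0-1 vector [w] has at most two ones, so a nonzero row of [w w^T] has diagonal entry 1 and at
    most one other 1. *)
Lemma DD_expose t : DD R _ (expose_vec t *m (expose_vec t)^T).
Proof.
set w := expose_vec t; split; first by rewrite /sym_mx /= trmx_mul trmxK.
have wE r c : (w *m w^T) r c = w r 0 * w c 0 by rewrite mxE big_ord1 [_^T _ _]mxE.
have w01 r : w r 0 = 0 \/ w r 0 = 1.
  by rewrite mxE; case: (_ || _); [right|left].
have w0 r : 0 <= w r 0 by case: (w01 r) => ->; rewrite ?ler01.
have w2 : \sum_r w r 0 <= 2.
  apply: (@le_trans _ _ (\sum_r (unit_vec (2 * t./2 + 1) r 0
      + unit_vec (2 * t./2 + 2) r 0))).
    apply: ler_sum => r _; rewrite !mxE -natrD ler_nat.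
    by case: (r == _ :> nat); case: (r == _ :> nat); case: (odd t).
  rewrite big_split/=; have := sum_unit_vec_le1 (2 * t./2 + 1).
  have := sum_unit_vec_le1 (2 * t./2 + 2); lra.
move=> r; rewrite wE; under eq_bigr do rewrite wE ger0_norm ?mulr_ge0//.
rewrite -mulr_sumr; case: (w01 r) => wr; rewrite wr ?mul0r// !mul1r.
by move: w2; rewrite (bigD1 r)//= wr; lra.
Qed.

(** * A single stage, with a fixed product [U] of kernel bases *)

Section Basis.
Variables (t k : nat) (U : 'M[R]_(n.+1, k)).
Hypotheses (tn : (t <= n)%N) (stU : stage_basis t U).

(** Dead rows of [U] are zeroed rather than deleted, so that [S] keeps [n.+1] rows. *)
Local Notation S := (alive_mx t *m U).
Local Notation w := (expose_vec t).
Local Notation v := (U^T *m w).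

Lemma stage_basis_col l : stage_space t (col l U).
Proof.
by have [_ _ _ spU] := stU; apply/spU; exists (delta_mx l 0); rewrite colE.
Qed.

Lemma stage_mx_basis : stage_mx t *m U = U.
Proof.
apply/matrixP => r l; have := stage_mx_id tn (stage_basis_col l).
move=> /colP/(_ r); rewrite [LHS]mxE [RHS]mxE => <-; rewrite mxE.
by apply: eq_bigr => i _; rewrite [col _ _ _ _]mxE.
Qed.

Lemma stage_basisE : U = stage_mx t *m S.
Proof. by rewrite mulmxA stage_alive_mx// stage_mx_basis. Qed.

Lemma alive_basis_entry r l : S r l != 0 -> alive t r /\ S r l = U r l.
Proof.
rewrite !mul_alive_mx; case: (alive t r); first by rewrite mul1r.
by rewrite mul0r eqxx.
Qed.

Lemma alive_basis_sign : sign_entries S.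
Proof.
have [sU _ _ _] := stU.
move=> r l; rewrite mul_alive_mx; case: (alive t r); first by rewrite mul1r.
by rewrite mul0r inE eqxx.
Qed.

Lemma alive_basis_row r l l' : S r l != 0 -> S r l' != 0 -> l = l'.
Proof.
have [_ /disjoint_col_supportsP dU _ _] := stU.
move=> Sl Sl'; have [_ El] := alive_basis_entry Sl.
have [_ El'] := alive_basis_entry Sl'.
by apply: (dU r); rewrite -?El -?El'.
Qed.

(** Some combination [U *m y] restricts to [e_r] on the alive coordinates. A column [l] with
    [S r l * y l 0 != 0] cannot meet another row [r']: by disjointness of supports, the combination
    would be nonzero at [r']. *)
Lemma alive_basis_unit (r : 'I_n.+1) : alive t r ->
  exists2 l, S r l != 0 & forall r', r' != r -> S r' l = 0.
Proof.
move=> ar; have [_ _ _ spU] := stU.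
have /spU[y Ey] := stage_mx_in (unit_vec r) tn.
have SyE r' : (S *m y) r' 0 = (r' == r)%:R.
  rewrite -mulmxA -Ey mul_alive_mx mul_stage_mx// unit_vecE val_eqE.
  have [ar'|ar'] := boolP (alive t r'); last first.
    by rewrite mul0r; have [e|//] := eqVneq r' r; case/negP: ar'; rewrite e.
  have -> : (odd t && (r' == 2 * t./2 + 2 :> nat))%N = false.
    by move: ar'; rewrite /alive; lia.
  by rewrite !mul1r mul0r subr0.
have [l Sl] : exists l, S r l * y l 0 != 0.
  apply/not_existsP => H; have := SyE r; rewrite eqxx mxE big1 => [|l _].
    by move/eqP; rewrite eq_sym oner_eq0.
  by apply/eqP; apply: contrapT => /negP /H.
move: Sl; rewrite mulf_eq0 negb_or => /andP[Sl yl].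
exists l => // r' rr; apply/eqP; apply: contrapT => /negP Sl'.
have := SyE r'; rewrite (negPf rr) mxE (@sum_single _ _ _ l) => [/eqP|l' ll].
  by rewrite mulf_eq0 (negPf Sl') (negPf yl).
have [->|/alive_basis_row/(_ Sl') e] := eqVneq (S r' l') 0; first by rewrite mul0r.
by rewrite e eqxx in ll.
Qed.

Lemma alive_basis_column r r' l : S r l != 0 -> S r' l != 0 -> r = r'.
Proof.
move=> Sl Sl'; have [/alive_basis_unit[l0 Sl0 S0] _] := alive_basis_entry Sl.
rewrite -(alive_basis_row Sl Sl0) in S0.
by have [//|/S0 e] := eqVneq r' r; rewrite e eqxx in Sl'.
Qed.

(** With [alive_basisK], this says that [S] is a signed permutation from the [k] coordinates onto
    the alive ones. *)
Lemma alive_basis_gram : S *m S^T = alive_mx t.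
Proof.
apply/matrixP => r r'; rewrite mxE [RHS]mxE.
have [ar|ar] := boolP (alive t r); last first.
  by rewrite andbF big1// => l _; rewrite mul_alive_mx (negPf ar) !mul0r.
have [l Sl S0] := alive_basis_unit ar.
rewrite andbT (@sum_single _ _ _ l) => [|l' ll].
  rewrite [S^T _ _]mxE; have [<-|] := eqVneq r r'.
    by rewrite -expr2; have [->] := sign_entriesP alive_basis_sign Sl.
  by rewrite eq_sym => /S0 ->; rewrite mulr0.
have [->|/alive_basis_row/(_ Sl) e] := eqVneq (S r l') 0; first by rewrite mul0r.
by rewrite e eqxx in ll.
Qed.

Lemma alive_mxK p (A : 'M[R]_(n.+1, p)) :
  alive_mx t *m (alive_mx t *m A) = alive_mx t *m A.
Proof.
apply/matrixP => r l; rewrite !mul_alive_mx.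
by case: (alive t r); rewrite ?mul1r ?mul0r.
Qed.

Lemma alive_basisK : S^T *m S = 1%:M.
Proof.
have [_ _ /mx_injP iU _] := stU.
have UE : U *m (S^T *m S) = U *m 1%:M.
  rewrite {1}stage_basisE mulmx1 -[stage_mx t *m S *m _]mulmxA.
  by rewrite (mulmxA S) alive_basis_gram alive_mxK -stage_basisE.
apply: trmx_inj; apply: (row_free_inj iU).
by rewrite -!trmx_mul UE.
Qed.

Lemma basis_alive_tr : U *m S^T = stage_mx t.
Proof. by rewrite {1}stage_basisE -mulmxA alive_basis_gram stage_alive_mx. Qed.

Lemma alive_basis_tr_mul (x : 'cV[R]_n.+1) r l :
  S r l != 0 -> (S^T *m x) l 0 = S r l * x r 0.
Proof.
move=> Sl; rewrite mxE (@sum_single _ _ _ r) => [|r' rr]; rewrite mxE //.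
have [->|/alive_basis_column/(_ Sl) e] := eqVneq (S r' l) 0.
  by rewrite mul0r.
by rewrite e eqxx in rr.
Qed.

Lemma expose_basisE : v = S^T *m w.
Proof.
apply/colP => l; rewrite !mxE; apply: eq_bigr => r _.
rewrite [S^T _ _]mxE [U^T _ _]mxE mul_alive_mx.
have [->|/expose_vec_alive ->] := eqVneq (w r 0) 0; first by rewrite !mulr0.
by rewrite mul1r.
Qed.

Lemma expose_orthogonal (X : 'M[R]_k) :
  reduced_set U (Lset R m) X -> (v^T *m X *m v) 0 0 = 0.
Proof.
move=> [symX]; rewrite /=; set Y := U *m X *m U^T => /LsetP[_ Y00 Yd Yq].
have colU l := stage_basis_col l.
have [tE|tlt] : t = n \/ (t < n)%N by lia.
  have -> : v = 0; last by rewrite mulmx0 mxE.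
  suff -> : w = 0 by rewrite mulmx0.
  apply/colP => r; rewrite !mxE tE; have := ltn_ord r.
  by case: (_ || _) / orP => //; lia.
have [ot|et] := boolP (odd t).
  pose ia : 'I_n.+1 := inord (2 * t./2 + 1).
  pose ib : 'I_n.+1 := inord (2 * t./2 + 2).
  have iaN : (ia : nat) = (2 * t./2 + 1)%N by rewrite inordK; lia.
  have ibN : (ib : nat) = (2 * t./2 + 2)%N by rewrite inordK; lia.
  have Uab : row ib U = - row ia U.
    apply/rowP => l; have [_ /(_ ot)] := colU l.
    by rewrite !mxE => /eqP; rewrite addrC addr_eq0 => /eqP.
  have YE r c : Y r c = (row r U *m X *m (row c U)^T) 0 0.
    rewrite -row_mul tr_row -[LHS](_ : (row r (U *m X) *m col c U^T) 0 0 = _)//.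
    by rewrite !mxE; apply: eq_bigr => l _; rewrite !mxE.
  have Ybb : Y ib ib = Y ia ia.
    by rewrite !YE Uab linearN /= mulNmx mulNmx mulmxN opprK.
  have Y0b : Y 0 ib = - Y 0 ia by rewrite !YE Uab linearN /= mulmxN mxE.
  have ia0 : ia != 0 by rewrite -val_eqE /= iaN; lia.
  have ib0 : ib != 0 by rewrite -val_eqE /= ibN; lia.
  have wE : w = unit_vec (2 * t./2 + 1).
    by apply/colP => r; rewrite !mxE ot orbF.
  have := Yd _ ia0; have := Yd _ ib0.
  have -> : (v^T *m X *m v) 0 0 = Y ia ia.
    rewrite trmx_mul trmxK mulmxA -(mulmxA w^T U) -(mulmxA w^T).
    rewrite -/Y wE mul_unit_vec; last by lia.
    rewrite mxE (@sum_single _ _ _ ia) => [|r rr].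
      by rewrite !mxE iaN eqxx mul1r.
    rewrite !mxE; case: eqP => [e|]; last by rewrite mul0r.
    by move: rr; rewrite -val_eqE /= iaN e eqxx.
  by rewrite Ybb Y0b; lra.
(* The vector [w] and the block differ at most at coordinate [2 * t./2], and only if it is positive;
   every column of [U] vanishes there. *)
have -> : v = U^T *m block_vec (t./2 + 1).
  apply/colP => l; rewrite !mxE; apply: eq_bigr => r _; rewrite !mxE.
  have [/eqP r2|r2] := boolP ((r == 2 * t./2 :> nat) && (0 < r))%N.
    have [/(_ r) + _] := colU l; rewrite mxE => ->; first by rewrite !mul0r.
    by lia.
  congr (_ * _%:R); rewrite /in_block; lia.
rewrite trmx_mul trmxK mulmxA -(mulmxA (block_vec _)^T U).
by rewrite -(mulmxA (block_vec _)^T) Yq ?mxE//; lia.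
Qed.

(** Congruences by [S] and by [S^T] preserve diagonal dominance, so [exposing_ray] can be moved to
    the reduced coordinates. *)
Lemma stage_cone Z :
  (perp (reduced_set U (Lset R m)) `&` @DD R k) Z <->
  exists2 c, 0 <= c & Z = c *: (v *m v^T).
Proof.
have vvE : v *m v^T = S^T *m (w *m w^T) *m S.
  by rewrite expose_basisE (trmx_mul S^T) trmxK !mulmxA.
split=> [[[symZ pZ] ddZ]|[c c0 ->]]; last first.
  have [symv ddv] : DD R k (v *m v^T).
    rewrite vvE -[X in _ *m X]trmxK; apply: DD_congr (DD_expose t).
    - by move=> l r; rewrite mxE; exact: alive_basis_sign.
    - by move=> l r r'; rewrite ![S^T _ _]mxE; exact: alive_basis_column.
    - by move=> l l' r; rewrite ![S^T _ _]mxE; exact: alive_basis_row.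
  split; split.
  - by rewrite /sym_mx /= linearZ /= symv.
  - move=> X /expose_orthogonal vX.
    by rewrite /mx_inner -scalemxAl linearZ /= -/(mx_inner _ _) mx_inner_rank1 vX mulr0.
  - by rewrite /sym_mx /= linearZ /= symv.
  move=> i; rewrite [leRHS]mxE; under eq_bigr do rewrite mxE normrM ger0_norm//.
  by rewrite -mulr_sumr ler_wpM2l.
have : exposing t (S *m Z *m S^T).
  split.
  - apply: DD_congr ddZ; [exact: alive_basis_sign|exact: alive_basis_row|].
    exact: alive_basis_column.
  - move=> r c ar; rewrite -!mulmxA mul_alive_mx.
    by rewrite (negPf ar) mul0r.
  (* Such an [X] equals [U X' U^T] with [X' = S^T X S], and pairing it with [S Z S^T] amounts to
     pairing [X'] with [Z]. *)
  move=> X LX PX; rewrite mx_inner_congr; apply: pZ; split.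
    have /LsetP[symX _ _ _] := LX.
    by rewrite /sym_mx /= trmx_mul (trmx_mul S^T) trmxK symX !mulmxA.
  suff -> : U *m (S^T *m X *m S) *m U^T = X by [].
  by rewrite -[RHS]PX -basis_alive_tr (trmx_mul U) trmxK !mulmxA.
case/(exposing_ray tn) => c c0 ZE; exists c => //.
rewrite vvE scalemxAl scalemxAr -ZE.
have -> : S^T *m (S *m Z *m S^T) *m S = (S^T *m S) *m Z *m (S^T *m S).
  by rewrite !mulmxA.
by rewrite alive_basisK mul1mx mulmx1.
Qed.

(** Provides the hypotheses of [sign_kernel_basis]: [q] is the column meeting row [a], and only the
    column meeting row [b] can be a second support index of [v]. *)
Lemma expose_pivot : (t < n)%N ->
  exists q, [/\ forall i, v i 0 \in [:: 0; 1; -1], v q 0 != 0 &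
  forall l l', l != q -> l' != q -> v l 0 != 0 -> v l' 0 != 0 -> l = l'].
Proof.
move=> tlt; pose ia : 'I_n.+1 := inord (2 * t./2 + 1).
have iaN : (ia : nat) = (2 * t./2 + 1)%N by rewrite inordK; lia.
have aa : alive t ia by rewrite iaN /alive; lia.
have [q Sq S0] := alive_basis_unit aa; rewrite expose_basisE.
have w01 r : w r 0 = 0 \/ w r 0 = 1.
  by rewrite mxE; case: (_ || _); [right|left].
have vE l : (S^T *m w) l 0 != 0 -> exists r, S r l != 0 /\ w r 0 != 0.
  move=> vl; apply/not_existsP => H; move/eqP: vl; apply.
  rewrite mxE big1// => r _; rewrite mxE.
  have [->|Sl] := eqVneq (S r l) 0; first by rewrite mul0r.
  have [->|wr] := eqVneq (w r 0) 0; first by rewrite mulr0.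
  by case: (H r).
exists q; split.
- move=> l; have [->|/vE[r [Sl _]]] := eqVneq ((S^T *m w) l 0) 0.
    by rewrite inE eqxx.
  rewrite (alive_basis_tr_mul _ Sl); case: (w01 r) => ->.
    by rewrite mulr0 inE eqxx.
  by rewrite mulr1; exact: alive_basis_sign.
- rewrite (alive_basis_tr_mul _ Sq) mulf_neq0// mxE iaN eqxx /=.
  exact: oner_neq0.
have vb l : l != q -> (S^T *m w) l 0 != 0 ->
    exists2 r : 'I_n.+1, r = (2 * t./2 + 2)%N :> nat & S r l != 0.
  move=> lq /vE[r [Sl]]; rewrite mxE; case: orP => [h _|]; last by rewrite eqxx.
  exists r => //; case: h => [/eqP ra|/andP[_ /eqP//]].
  have e : r = ia by apply: val_inj; rewrite /= iaN.
  by rewrite e in Sl; rewrite (alive_basis_row Sl Sq) eqxx in lq.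
move=> l l' lq lq' /(vb _ lq)[r rb Sl] /(vb _ lq')[r' rb' Sl'].
have e : r = r' by apply: val_inj; rewrite /= rb rb'.
by rewrite e in Sl; exact: alive_basis_row Sl Sl'.
Qed.

(** Each row of [U] has at most one nonzero entry, so a row of [U *m V] is zero or, up to sign, a
    row of [V]. The kernel condition on [V] is the equation that [stage_space_step] adds. *)
Lemma stage_basis_step p c (V : 'M[R]_(k, p)) : (t < n)%N -> c != 0 ->
  ker_basis_mx (c *: (v *m v^T)) V -> sign_entries V ->
  disjoint_col_supports V -> stage_basis t.+1 (U *m V).
Proof.
move=> tlt c0 kV sV /disjoint_col_supportsP dV.
have [sU /disjoint_col_supportsP dU iU spU] := stU.
have [q [_ vq _]] := expose_pivot tlt.
have v0 : v != 0 by apply/eqP => e; rewrite e mxE eqxx in vq.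
have [iV kerV] := (ker_basis_rank1 V c0 v0).1 kV.
have UVE r l0 l : U r l0 != 0 -> (U *m V) r l = U r l0 * V l0 l.
  move=> Ul; rewrite mxE (@sum_single _ _ _ l0)// => l' ll.
  have [->|/dU/(_ Ul) e] := eqVneq (U r l') 0; first by rewrite mul0r.
  by rewrite e eqxx in ll.
have UV0 r l : (U *m V) r l != 0 -> exists2 l0, U r l0 != 0 & V l0 l != 0.
  move=> UVl; have [l0 Ul] : exists l0, U r l0 != 0.
    apply/not_existsP => H; move/eqP: UVl; apply; rewrite mxE big1// => l' _.
    have [->|Ul] := eqVneq (U r l') 0; first by rewrite mul0r.
    by case: (H l').
  by exists l0 => //; move: UVl; rewrite (UVE _ l0)// mulf_eq0 negb_or => /andP[].
split.
- move=> r l; have [->|UVl] := eqVneq ((U *m V) r l) 0; first by rewrite inE eqxx.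
  have [l0 Ul _] := UV0 _ _ UVl; rewrite (UVE _ l0)//.
  have := sU r l0; have := sV l0 l; rewrite !inE.
  by case/or3P=> /eqP->; case/or3P=> /eqP->;
    rewrite ?mulr0 ?mul0r ?mulr1 ?mulrN1 ?opprK ?oppr0 ?eqxx ?orbT.
- apply/disjoint_col_supportsP => r l l' /UV0[l0 Ul0 Vl0] /UV0[l1 Ul1 Vl1].
  by rewrite (dU _ _ _ Ul1 Ul0) in Vl1; exact: dV Vl0 Vl1.
- by move=> y; rewrite -mulmxA => /iU/iV.
move=> x; rewrite stage_space_step// spU; split=> [[[z ->]]|[y ->]].
  rewrite mulmxA -[w^T *m U]trmxK trmx_mul trmxK => /kerV[y ->].
  by exists y; rewrite mulmxA.
split; first by exists (V *m y); rewrite mulmxA.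
rewrite !mulmxA -[w^T *m U]trmxK trmx_mul trmxK -mulmxA.
by apply/kerV; exists y.
Qed.

Lemma stage_terminal : t = n -> dd_terminal (reduced_set U (Lset R m)).
Proof.
move=> tE; have v0 : v = 0.
  suff -> : w = 0 by rewrite mulmx0.
  apply/colP => r; rewrite !mxE tE; have := ltn_ord r.
  by case: (_ || _) / orP => //; lia.
rewrite /dd_terminal; apply/seteqP; split=> Z.
  by move=> /stage_cone[c _ ->]; rewrite v0 mul0mx scaler0.
by move=> ->; apply/stage_cone; exists 0; rewrite ?scale0r.
Qed.

End Basis.

(** Induction on the number [d] of remaining steps. The relative interior of the ray consists of the
    positive multiples of [v *m v^T], so all exposing matrices have the same kernel. *)
Lemma stage_requires d t k (U : 'M[R]_(n.+1, k)) :
  (t + d = n)%N -> stage_basis t U ->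
  dd_fr_requires d (reduced_set U (Lset R m)).
Proof.
elim: d t k U => [|d IH] t k U tdn stU.
  by apply: (stage_terminal _ stU); lia.
have tn : (t <= n)%N by lia.
have tlt : (t < n)%N by lia.
set v := U^T *m expose_vec t.
have [q [v_sign vq v_other]] := expose_pivot tn stU tlt; rewrite -/v in v_sign vq v_other.
have vv0 : v *m v^T != 0.
  apply/eqP => /matrixP/(_ q q); rewrite mxE big_ord1 !mxE => /eqP.
  by move: vq; rewrite mxE mulf_eq0 orbb => /negPf ->.
have cone Z := stage_cone tn stU Z; rewrite -/v in cone.
have ri Z := rel_interior_ray vv0 cone Z.
have v0 : v != 0 by apply/eqP => e; rewrite e mxE eqxx in vq.
split.
- move=> term; have /cone : exists2 c, 0 <= c & v *m v^T = c *: (v *m v^T).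
    by exists 1; rewrite ?ler01 ?scale1r.
  by rewrite term => /= e; rewrite e eqxx in vv0.
- have [p [V [sV dV iV kV]]] := sign_kernel_basis v_sign vq v_other.
  exists p, (reduced_set V (reduced_set U (Lset R m))), (v *m v^T), V; split.
    by apply/ri; exists 1; rewrite ?ltr01 ?scale1r.
  split=> //; rewrite -[v *m v^T]scale1r.
  exact/(ker_basis_rank1 V (oner_neq0 _) v0).
move=> p L' [W [V [/ri[c c0 ->] [kV sV dV ->]]]].
rewrite reduced_set_comp; apply: (IH t.+1); first by lia.
by apply: (stage_basis_step tn stU tlt _ kV) => //; rewrite gt_eqF.
Qed.

End Reduction.

Theorem corollary4p1 (R : realType) (m : nat) (hm : (1 <= m)%N) :
  dd_fr_requires (2 * m)%N (Lset R m).
Proof.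
(* Before any step the product of kernel bases is the identity; reducing along it changes nothing
   because [Lset] contains only symmetric matrices. *)
have -> : Lset R m = reduced_set 1%:M (Lset R m).
  apply/seteqP; split=> X; last by case; rewrite mul1mx trmx1 mulmx1.
  by move=> LX; split; [case/LsetP: LX | rewrite mul1mx trmx1 mulmx1].
apply: (@stage_requires R m (2 * m) 0); first by [].
split.
- by move=> i j; rewrite mxE; case: (i == j); rewrite !inE eqxx ?orbT.
- apply/disjoint_col_supportsP => i j j'; rewrite !mxE.
  case: (i =P j) => [<- _|_]; last by rewrite eqxx.
  by case: (i =P j') => [//|_]; rewrite eqxx.
- by move=> y; rewrite mul1mx.
move=> x; split=> [_|_]; first by exists x; rewrite mul1mx.
by split=> // r; rewrite /=; lia.
Qed.
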